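(* Let $G$ be a countable sofic group and let $(K_1,\kappa_1)$, $(K_2,\kappa_2)$ be standard Borel probability spaces such that $H(\kappa_1)+H(\kappa_2)<\infty$. If $(G,K_1^G,\kappa_1^G)$ is conjugate up to automorphisms to $(G,K_2^G,\kappa_2^G)$, then $H(\kappa_1)=H(\kappa_2)$.
   Context: A countable group $G$ is sofic if there is a sequence of maps $\sigma_i:G\to\mathrm{Sym}(m_i)$ (not necessarily homomorphisms) and finite sets $F_1\subset F_2\subset\cdots$ with $\bigcup_iF_i=G$ and $\epsilon_i\to0$ such that for each $i$ the set of $v\in\{1,\dots,m_i\}$ with $\sigma_i(f_1)\sigma_i(f_2)v=\sigma_i(f_1f_2)v$ for all $f_1,f_2\in F_i$ and $\sigma_i(f_1)v\neq\sigma_i(f_2)v$ for distinct $f_1,f_2\in F_i$ has at least $(1-\epsilon_i)m_i$ elements. The Bernoulli shift $(G,K^G,\kappa^G)$ is the action $(gx)(f)=x(g^{-1}f)$ on $K^G$ with product measure. $H(\kappa)=-\sum_k\kappa(\{k\})\log\kappa(\{k\})$ if $\kappa$ is supported on a countable set, else $+\infty$. Two systems $(G_1,X_1,\mu_1)$ and $(G_2,X_2,\mu_2)$ are conjugate up to automorphisms if there exist a group isomorphism $\Phi:G_1\to G_2$, conull sets $X_i'\subset X_i$ and a measure-space isomorphism $\phi:X_1'\to X_2'$ with $\phi(gx)=\Phi(g)\phi(x)$ for all $g\in G_1$, $x\in X_1'$. *)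

(* Defs.v *)
From HB Require Import structures.
From mathcomp Require Import all_boot all_order all_algebra all_fingroup.
From mathcomp Require Import all_classical all_reals all_analysis.
Set Implicit Arguments. Unset Strict Implicit. Unset Printing Implicit Defensive.
Import Order.TTheory GRing.Theory Num.Theory numFieldNormedType.Exports.
Local Open Scope classical_set_scope.
Local Open Scope ring_scope.

Record cgroup := CGroup {
  gcar :> Type;
  gmul : gcar -> gcar -> gcar;
  gone : gcar;
  ginv : gcar -> gcar;
  gmulA : forall x y z, gmul x (gmul y z) = gmul (gmul x y) z;
  gmul1 : forall x, gmul gone x = x;
  gmulV : forall x, gmul (ginv x) x = gone }.

Definition countable_group (G : cgroup) : Prop := countable [set: gcar G].

Definition group_iso (G1 G2 : cgroup) (Phi : gcar G1 -> gcar G2) : Prop :=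
  bijective Phi /\ forall x y, Phi (gmul x y) = gmul (Phi x) (Phi y).

Definition sofic (R : realType) (G : cgroup) : Prop :=
  exists (m : nat -> nat) (sigma : forall i, gcar G -> {perm 'I_(m i)})
         (F : nat -> set (gcar G)) (eps : nat -> R),
    (forall i, 0 < m i)%N /\
    (forall i, finite_set (F i)) /\
    (forall i, F i `<=` F i.+1) /\
    \bigcup_i F i = [set: gcar G] /\
    (eps : R^nat) @ \oo --> (0 : R) /\
    forall i,
      (1 - eps i) * (m i)%:R <=
      #|[set v : 'I_(m i) | `[<
          (forall f1 f2, F i f1 -> F i f2 ->
             sigma i f1 (sigma i f2 v) = sigma i (gmul f1 f2) v) /\
          (forall f1 f2, F i f1 -> F i f2 -> f1 <> f2 ->
             sigma i f1 v <> sigma i f2 v) >]]|%:R.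

(* A measurable space is standard Borel iff it is Borel-isomorphic to a
   Borel subset of the real line. *)
Definition standard_Borel (R : realType) d (K : measurableType d) : Prop :=
  exists (B : set R) (f : K -> R),
    measurable B /\ f @` [set: K] = B /\ injective f /\
    measurable_fun [set: K] f /\
    (forall A : set K, measurable A -> measurable (f @` A)).

Definition entropy (R : realType) d (K : measurableType d)
  (kappa : probability K R) : \bar R :=
  if `[< exists S : set K, countable S /\ measurable S /\ kappa (~` S) = 0%E >]
  then (\esum_(k in [set: K])
          (- fine (kappa [set k]) * ln (fine (kappa [set k])))%:E)%E
  else +oo%E.

Definition cylinders (G : cgroup) d (K : measurableType d) : set (set (gcar G -> K)) :=
  [set C | exists (g : gcar G) (A : set K), measurable A /\ C = [set x | A (x g)]].

Definition shift_space (G : cgroup) d (K : measurableType d) :=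
  g_sigma_algebraType (@cylinders G d K).

Definition shift (G : cgroup) (K : Type) (g : gcar G) (x : gcar G -> K) : gcar G -> K :=
  fun f => x (gmul (ginv g) f).

Definition is_product_measure (R : realType) (G : cgroup) d (K : measurableType d)
  (kappa : probability K R) (mu : probability (shift_space G K) R) : Prop :=
  forall (n : nat) (gs : 'I_n -> gcar G) (As : 'I_n -> set K),
    injective gs -> (forall i, measurable (As i)) ->
    mu [set x : shift_space G K | forall i, As i (x (gs i))] =
    (\prod_(i < n) kappa (As i))%E.

Definition conj_up_to_aut (R : realType) (G : cgroup)
  d1 (K1 : measurableType d1) d2 (K2 : measurableType d2)
  (mu1 : probability (shift_space G K1) R)
  (mu2 : probability (shift_space G K2) R) : Prop :=
  exists (Phi : gcar G -> gcar G) (X1 : set (shift_space G K1)) (X2 : set (shift_space G K2))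
         (phi : shift_space G K1 -> shift_space G K2)
         (psi : shift_space G K2 -> shift_space G K1),
    group_iso Phi /\
    measurable X1 /\ mu1 X1 = 1%E /\ measurable X2 /\ mu2 X2 = 1%E /\
    (forall x, X1 x -> X2 (phi x) /\ psi (phi x) = x) /\
    (forall y, X2 y -> X1 (psi y) /\ phi (psi y) = y) /\
    (forall B, measurable B -> B `<=` X2 ->
       measurable (X1 `&` phi @^-1` B) /\ mu1 (X1 `&` phi @^-1` B) = mu2 B) /\
    (forall A, measurable A -> A `<=` X1 ->
       measurable (X2 `&` psi @^-1` A) /\ mu2 (X2 `&` psi @^-1` A) = mu1 A) /\
    (forall (g : gcar G) x, X1 x ->
       X1 (shift g x) /\ phi (shift g x) = shift (Phi g) (phi x)).

(* Main.v *)
(** If [w] is an i.i.d. labelling of the vertices of a sofic approximation by a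
finite quotient of [kappa2], a local rule approximating the conjugacy
[psi : K2^G -> K1^G] turns [w] into a labelling [w'] whose letters are, at almost
every vertex, distributed nearly as a finite quotient of [kappa1]. A local rule
approximating [phi] recovers from [w'] almost all the letters of a given finite
partition [al] of [K2]. Hence the entropy [m * H(kappa2, al)] of the [m] letters
of [w] is at most the sum of the entropies of the letters of [w'], about
[m * H(kappa1)], plus an error [o(m)]. Letting the partition [al] vary gives
[H(kappa2) <= H(kappa1)]; both [phi] and [psi] enter, so this is an argument about
conjugacies and not about factor maps. The entropy comparison is Gibbs'
inequality against an explicit measure, see [coding_entropy_bound]. *)

From HB Require Import structures.
Require Import Defs.
From mathcomp Require Import all_boot all_order all_algebra all_fingroup.
From mathcomp Require Import all_classical all_reals all_analysis.
From mathcomp Require Import lra.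
Set Implicit Arguments. Unset Strict Implicit. Unset Printing Implicit Defensive.
Import Order.TTheory GRing.Theory Num.Theory numFieldNormedType.Exports.
Local Open Scope classical_set_scope.
Local Open Scope ring_scope.

(** * Finite information inequality *)

Section finite.
Context {R : realType}.

(** The labellings [w] that restrict to a given [l] along [J] form a product of per-vertex
    constraints, so their total weight factors over [V]. A vertex outside the image of [J] is free
    and contributes [1]. The vertex [J i] contributes [p (l i)], and injectivity of [J] keeps these
    constraints from colliding. *)
Lemma sum_prod_marginal (I V B : finType) (J : I -> V) (p : B -> R)
    (S : {ffun I -> B} -> R) : injective J -> \sum_b p b = 1 ->
  \sum_(w : {ffun V -> B}) (\prod_v p (w v)) * S [ffun i => w (J i)] =
  \sum_(l : {ffun I -> B}) (\prod_i p (l i)) * S l.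
Proof.
move=> Jinj p1.
rewrite (partition_big (fun w : {ffun V -> B} => [ffun i => w (J i)]) predT) //=.
apply: eq_bigr => l _.
under eq_bigr => w /eqP e do rewrite e.
rewrite -big_distrl /=; congr (_ * _).
(* [F v] holds the letters allowed at [v]: all of them off the image of [J], only [l i] at
   [v = J i]. *)
pose F v : pred B := fun b => [forall i, (J i == v) ==> (b == l i)].
rewrite (eq_bigl (fun w : {ffun V -> B} => w \in family F)); last first.
  move=> w; apply/eqP/familyP => [e v|H].
    by apply/forallP => i; apply/implyP => /eqP <-; rewrite -e ffunE.
  apply/ffunP => i; rewrite ffunE.
  by have /forallP /(_ i) := H (J i); rewrite eqxx /= => /eqP.
rewrite -(bigA_distr_big_dep F (fun _ b => p b)).
rewrite (bigID (fun v => v \in codom J)) /= [X in _ * X]big1 ?mulr1; last first.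
  move=> v vJ; rewrite -[RHS]p1; apply: eq_bigl => b.
  apply/forallP => i; apply/implyP => /eqP e.
  by rewrite -e codom_f in vJ.
rewrite -(big_uniq (codom J)) /=; last by rewrite map_inj_uniq // enum_uniq.
rewrite big_map big_enum /=; apply: eq_bigr => i _.
rewrite (big_pred1 (l i)) // => b; apply/forallP/eqP => [/(_ i)|-> j].
  by rewrite eqxx /= => /eqP.
by apply/implyP => /eqP /Jinj ->.
Qed.

Lemma sum_prod_coord (V B : finType) (v : V) (p : B -> R) (g : B -> R) :
  \sum_b p b = 1 ->
  \sum_(w : {ffun V -> B}) (\prod_u p (w u)) * g (w v) = \sum_b p b * g b.
Proof.
move=> p1.
have := @sum_prod_marginal unit V B (fun=> v) p (fun l => g (l tt)).
move=> /(_ _ p1) H.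
transitivity (\sum_(w : {ffun V -> B}) (\prod_u p (w u)) * g ([ffun _ : unit => w v] tt)).
  by apply: eq_bigr => w _; rewrite ffunE.
rewrite H; last by case; case.
rewrite (reindex (fun b => [ffun _ : unit => b])) /=; last first.
    exists (fun l : {ffun unit -> B} => l tt) => [b _|l _]; first by rewrite ffunE.
    by apply/ffunP; case; rewrite ffunE.
apply: eq_bigr => b _; rewrite ffunE; congr (_ * _).
by rewrite (big_pred1 tt) ?ffunE //; case.
Qed.

Lemma sum_prod_ffun1 (V B : finType) (q : V -> B -> R) :
  (forall v, \sum_b q v b = 1) -> \sum_(w : {ffun V -> B}) \prod_v q v (w v) = 1.
Proof. by move=> q1; rewrite -bigA_distr_bigA big1. Qed.

Lemma lnprod (I : finType) (f : I -> R) : (forall i, 0 < f i) ->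
  ln (\prod_i f i) = \sum_i ln (f i).
Proof.
move=> f0; suff [//] : ln (\prod_i f i) = \sum_i ln (f i) /\ 0 < \prod_i f i.
elim/big_rec2 : _ => [|i y x _ [<- x0]]; first by rewrite ln1.
by rewrite lnM ?posrE// mulr_gt0.
Qed.

(* Gibbs' inequality against the law of a random [z] obtained by drawing [u]
   with independent letters of law [q1], then [z v] of law [q2 (w2 u v)]. *)
Lemma coding_entropy_bound (V A A1 B : finType) (p : B -> R) (c : B -> A)
    (w1 : {ffun V -> B} -> {ffun V -> A1})
    (w2 : {ffun V -> A1} -> {ffun V -> A}) (pA : A -> R) (q1 : A1 -> R) (q2 : A -> A -> R) :
  (forall b, 0 <= p b) -> \sum_b p b = 1 ->
  (forall a, 0 < q1 a) -> \sum_a q1 a = 1 ->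
  (forall a b, 0 < q2 a b) -> (forall a, \sum_b q2 a b = 1) ->
  (forall a, pA a = \sum_(b | c b == a) p b) ->
  #|V|%:R * \sum_a (- (pA a * ln (pA a))) <=
  \sum_v (\sum_(w : {ffun V -> B}) (\prod_u p (w u)) * (- ln (q1 (w1 w v))) +
          \sum_(w : {ffun V -> B}) (\prod_u p (w u)) * (- ln (q2 (w2 (w1 w) v) (c (w v))))).
Proof.
move=> p0 p1 q10 q11 q20 q21 pAE.
pose W (w : {ffun V -> B}) := \prod_u p (w u).
have pA0 a : 0 <= pA a by rewrite pAE; apply: sumr_ge0.
have W0 w : 0 <= W w by apply: prodr_ge0.
(* [t w] is the reference probability of drawing [u = w1 w] and then [z = c \o w]; [Q] is the
   reference law of [z] alone and [PA] its true law. *)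
pose t w := \prod_v q1 (w1 w v) * \prod_v q2 (w2 (w1 w) v) (c (w v)).
pose Q (z : {ffun V -> A}) := \sum_(u : {ffun V -> A1})
  \prod_v q1 (u v) * \prod_v q2 (w2 u v) (z v).
pose cc (w : {ffun V -> B}) := [ffun v => c (w v)].
pose PA (z : {ffun V -> A}) := \prod_v pA (z v).
have PAE z : PA z = \sum_(w | cc w == z) W w.
  rewrite /PA; under eq_bigr do rewrite pAE.
  rewrite (bigA_distr_big_dep (fun v b => c b == z v) (fun _ b => p b)); apply: eq_bigl => w.
  apply/familyP/eqP => [H|<- v]; first by apply/ffunP => v; rewrite ffunE; apply/eqP/H.
  by rewrite ffunE unfold_in /=.
have t0 w : 0 < t w by apply: mulr_gt0; apply: prodr_gt0 => i _.
(* Only the term [u = w1 w] of the sum [Q (cc w)] is kept. *)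
have tQ w : t w <= Q (cc w).
  rewrite /Q (bigD1 (w1 w)) //= -[leLHS]addr0; apply: lerD; last first.
    by apply: sumr_ge0 => u _; apply: mulr_ge0; apply: prodr_ge0 => i _; exact: ltW.
  rewrite /t le_eqVlt; apply/orP; left; apply/eqP; congr (_ * _).
  by apply: eq_bigr => v _; rewrite ffunE.
have Q1 : \sum_z Q z = 1.
  rewrite exchange_big /=.
  under eq_bigr => u _ do
    rewrite -big_distrr /= (sum_prod_ffun1 (q := fun v b => q2 (w2 u v) b))// mulr1.
  exact: (sum_prod_ffun1 (q := fun _ => q1)).
have W1 : \sum_(w : {ffun V -> B}) W w = 1.
  exact: (sum_prod_ffun1 (q := fun _ => p)).
have PA0 w : 0 < W w -> forall v, 0 < pA (c (w v)).
  move=> Ww v; rewrite lt_neqAle pA0 andbT eq_sym; apply: contraTneq Ww => e.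
  rewrite -leNgt /W (bigD1 v) //=.
  suff -> : p (w v) = 0 by rewrite mul0r.
  apply/le_anti; rewrite p0 andbT -e pAE (bigD1 (w v)) //= lerDl.
  exact: sumr_ge0.
(* Use [ln x <= x - 1] at [x = t w / PA (cc w)], then [tQ]. Summed over the fibres of [cc], the
   weights [W] cancel [PA], leaving at most the total mass of [Q] minus [1]. *)
have main : \sum_w W w * (ln (t w) - ln (PA (cc w))) <= 0.
  apply: (@le_trans _ _ (\sum_w (W w * (Q (cc w) / PA (cc w)) - W w))).
    apply: ler_sum => w _; have := W0 w; rewrite le_eqVlt => /predU1P[<-|Ww].
      by rewrite !mul0r subr0.
    have Pw : 0 < PA (cc w) by apply: prodr_gt0 => v _; rewrite ffunE PA0.
    rewrite -ln_div ?posrE// -[X in _ - X]mulr1 -mulrBr ler_pM2l//.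
    have := @le_ln1Dx R (t w / PA (cc w) - 1).
    rewrite [1 + _]addrC subrK ltrDr divr_gt0// => /(_ isT) H.
    by apply: (le_trans H); rewrite lerB // ler_pM2r ?invr_gt0.
  rewrite sumrB W1 subr_le0 (partition_big cc predT) //= -Q1.
  apply: ler_sum => z _.
  under eq_bigr => w /eqP e do rewrite e.
  rewrite -big_distrl /= -PAE mulrCA.
  have Q0 : 0 <= Q z.
    by apply: sumr_ge0 => u _; apply: mulr_ge0; apply: prodr_ge0 => i _; exact: ltW.
  have [->|nz] := eqVneq (PA z) 0; first by rewrite mul0r mulr0.
  by rewrite divff// mulr1.
rewrite big_split /= [X in _ <= X + _]exchange_big [X in _ <= _ + X]exchange_big /=.
rewrite -big_split /=.
(* The letters are independent and identically distributed, so the entropy of their joint law is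
   [#|V|] times that of one letter. *)
have <- : \sum_w W w * (- \sum_v ln (pA (c (w v)))) =
    #|V|%:R * \sum_a - (pA a * ln (pA a)).
  under eq_bigr do rewrite -sumrN big_distrr /=.
  rewrite exchange_big /=.
  under eq_bigr => v _ do rewrite (sum_prod_coord v (fun b => - ln (pA (c b)))) //.
  rewrite sumr_const [RHS]mulr_natl; congr (_ *+ _).
  rewrite (partition_big c predT) //=; apply: eq_bigr => a _.
  under eq_bigr => b /eqP e do rewrite e.
  by rewrite -big_distrl /= mulrN -pAE.
rewrite -subr_le0 -sumrB; apply: le_trans main; rewrite le_eqVlt; apply/orP; left.
apply/eqP; apply: eq_bigr => w _.
rewrite -/(W w); have := W0 w; rewrite le_eqVlt => /predU1P[<-|Ww].
  by rewrite !mul0r !big1 ?addr0 ?subr0 // => v _; rewrite mul0r.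
rewrite -!big_distrr /= -mulrDr -mulrBr; congr (_ * _).
rewrite /t lnM ?posrE; [|exact: prodr_gt0..].
rewrite !lnprod//; last by move=> v; rewrite ffunE PA0.
rewrite !sumrN opprD !opprK addrC; congr (_ + _).
by congr (- _); apply: eq_bigr => v _; rewrite ffunE.
Qed.

End finite.

(** * Local functions on the shift space *)

HB.instance Definition _ (G : cgroup) := gen_eqMixin (gcar G).
HB.instance Definition _ (G : cgroup) := gen_choiceMixin (gcar G).

Section group.
Variable G : cgroup.
Implicit Types x y z : gcar G.

Lemma gmulVr x : gmul x (ginv x) = gone G.
Proof.
rewrite -[LHS]gmul1 -{1}(gmulV (ginv x)) -gmulA [gmul (ginv x) _]gmulA.
by rewrite gmulV gmul1 gmulV.
Qed.

Lemma gmulr1 x : gmul x (gone G) = x.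
Proof. by rewrite -(gmulV x) gmulA gmulVr gmul1. Qed.

Lemma gmulK x y : gmul (ginv x) (gmul x y) = y.
Proof. by rewrite gmulA gmulV gmul1. Qed.

Lemma gmulKV x y : gmul x (gmul (ginv x) y) = y.
Proof. by rewrite gmulA gmulVr gmul1. Qed.

Lemma gmulI x : injective (gmul x).
Proof. by move=> y z /(congr1 (gmul (ginv x))); rewrite !gmulK. Qed.

Lemma ginvK x : ginv (ginv x) = x.
Proof. by apply: (@gmulI (ginv x)); rewrite gmulV gmulVr. Qed.

Lemma ginv_inj : injective (@ginv G).
Proof. exact: can_inj ginvK. Qed.

Lemma ginvM x y : ginv (gmul x y) = gmul (ginv y) (ginv x).
Proof.
by apply: (@gmulI (gmul x y)); rewrite gmulVr -gmulA gmulKV gmulVr.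
Qed.

Lemma ginv1 : ginv (gone G) = gone G.
Proof. by rewrite -[LHS]gmul1 gmulVr. Qed.

End group.

Lemma fsbig_finType (R : Type) (idx : R) (op : Monoid.com_law idx) (I : finType)
    (P : pred I) (f : I -> R) :
  \big[op/idx]_(i \in [set` P]) f i = \big[op/idx]_(i | P i) f i.
Proof.
rewrite (_ : [set` P] = [set` enum P]); last first.
  by apply/seteqP; split => i /=; rewrite mem_enum.
by rewrite -fsbig_seq ?enum_uniq// big_enum.
Qed.

Section finitary.
Context d (T : measurableType d) (R : realType) (mu : probability T R).

(** Finite alphabets carry no sigma-algebra here; for a finite target, testing on points amounts to
    measurability for the discrete one. *)
Definition fmeasurable (A : Type) (f : T -> A) :=
  forall a, measurable (f @^-1` [set a]).

Lemma fmeasurable_preimage (A : finType) (f : T -> A) (S : set A) :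
  fmeasurable f -> measurable (f @^-1` S).
Proof.
move=> mf; rewrite (_ : _ @^-1` _ = \bigcup_(a in S) f @^-1` [set a]).
  by apply: fin_bigcup_measurable.
by apply/seteqP; split=> [x Sx|x [a Sa /= fa]]; [by exists (f x)|rewrite /= fa].
Qed.

Lemma fmeasurable_comp (A : finType) (B : Type) (f : T -> A) (h : A -> B) :
  fmeasurable f -> fmeasurable (h \o f).
Proof. by move=> mf b; rewrite comp_preimage; exact: fmeasurable_preimage. Qed.

Lemma fmeasurable_pair (A B : Type) (f : T -> A) (g : T -> B) :
  fmeasurable f -> fmeasurable g -> fmeasurable (fun x => (f x, g x)).
Proof.
move=> mf mg [a b].
rewrite (_ : _ @^-1` _ = f @^-1` [set a] `&` g @^-1` [set b]).
  exact: measurableI.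
by apply/seteqP; split => x /= [-> ->].
Qed.

Lemma fmeasurable_ffun (I : finType) (A : I -> finType) (f : forall i, T -> A i) :
  (forall i, fmeasurable (f i)) ->
  fmeasurable (fun x => [ffun i => f i x] : {dffun forall i, A i}).
Proof.
move=> mf l.
rewrite (_ : _ @^-1` _ = \bigcap_(i in [set: I]) f i @^-1` [set l i]).
  by apply: fin_bigcap_measurable => // i _; exact: mf.
apply/seteqP; split => [x /= <- i _ /=|x /= H]; first by rewrite ffunE.
by apply/ffunP => i; rewrite ffunE; exact: H.
Qed.

Lemma fmeasurable_neq (A : finType) (f : T -> A) (g : T -> A) :
  fmeasurable f -> fmeasurable g -> measurable [set x | f x != g x].
Proof.
move=> mf mg.
rewrite (_ : mkset _ = (fun x => (f x, g x)) @^-1` [set y | y.1 != y.2]) //.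
exact/fmeasurable_preimage/fmeasurable_pair.
Qed.

Lemma measure_fpreimage (A : finType) (f : T -> A) (P : pred A) :
  fmeasurable f ->
  mu (f @^-1` [set` P]) = (\sum_(a | P a) mu (f @^-1` [set a]))%E.
Proof.
move=> mf.
rewrite (_ : _ @^-1` _ = \bigcup_(a in [set` P]) f @^-1` [set a]).
  rewrite measure_fin_bigcup//.
    exact: fsbig_finType.
  by move=> a b _ _ [x [/= <- <-]].
by apply/seteqP; split=> [x Px|x [a Sa /= fa]]; [by exists (f x)|rewrite /= fa].
Qed.

Lemma measure_bigU_le (I : finType) (F : I -> set T) (E : set T) (e : R) :
  (forall i, measurable (F i)) -> measurable E ->
  E `<=` \bigcup_(i in [set: I]) F i -> (forall i, mu (F i) <= e%:E)%E ->
  (mu E <= (#|I|%:R * e)%:E)%E.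
Proof.
move=> mF mE EF Fe; apply: le_trans (content_sub_fsum mu _ _ mE EF) _ => //.
  exact: finite_finset.
rewrite (_ : [set: I] = [set` predT]); last by apply/seteqP.
rewrite fsbig_finType.
apply: le_trans (lee_sum _ (fun i _ => Fe i)) _.
by rewrite sumEFin lee_fin sumr_const mulr_natl.
Qed.

Lemma fine_measureK E : measurable E -> (fine (mu E))%:E = mu E.
Proof. by move=> mE; rewrite fineK//; exact: fin_num_measure. Qed.

End finitary.

(** * Finite windows, cylinder probabilities and shift invariance *)

Section window.
Variable G : cgroup.

Definition local (A B : Type) (T : seq (gcar G)) (h : (gcar G -> A) -> B) :=
  forall z z', {in T, z =1 z'} -> h z = h z'.

(** Patterns are indexed by positions in [T], not by group elements, so that they form a finite
    type. *)
Definition window (A : finType) (T : seq (gcar G)) (z : gcar G -> A) :=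
  [ffun i : 'I_(size T) => z (tnth (in_tuple T) i)].

Lemma tnth_inj (T : seq (gcar G)) : uniq T -> injective (tnth (in_tuple T)).
Proof. by move=> uT; apply/(tuple_uniqP (in_tuple T)). Qed.

Lemma eq_window (A : finType) T (z z' : gcar G -> A) :
  window T z = window T z' -> {in T, z =1 z'}.
Proof.
move=> e t /seq_tnthP [i ->].
by move/ffunP : e => /(_ i); rewrite !ffunE.
Qed.

Lemma local_window (A : finType) T (P : (gcar G -> A) -> bool) : local T P ->
  exists S : pred {ffun 'I_(size T) -> A}, forall z, P z = S (window T z).
Proof.
move=> lP; exists (fun l => `[< exists z, window T z = l /\ P z >]) => z.
apply/idP/asboolP => [Pz|[z' [/eq_window/lP <-]]//].
by exists z.
Qed.

Lemma sub_local (A B : Type) T T' (h : (gcar G -> A) -> B) :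
  {subset T <= T'} -> local T h -> local T' h.
Proof. by move=> TT' lh z z' e; apply: lh => t /TT'; exact: e. Qed.

Context d (K : measurableType d).

Lemma measurable_coord (g : gcar G) (D : set K) : measurable D ->
  measurable [set x : shift_space G K | D (x g)].
Proof. by move=> mD; apply: sub_sigma_algebra; exists g, D. Qed.

Lemma fmeasurable_window (A : finType) T (b : K -> A) : fmeasurable b ->
  fmeasurable (fun x : shift_space G K => window T (b \o x)).
Proof.
move=> mb.
apply: (@fmeasurable_ffun _ _ _ (fun=> A)
  (fun i (x : shift_space G K) => b (x (tnth (in_tuple T) i)))) => i a.
exact: (measurable_coord _ (mb a)).
Qed.

Lemma fmeasurable_local (A B : finType) T (b : K -> A) (h : (gcar G -> A) -> B) :
  fmeasurable b -> local T h ->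
  fmeasurable (fun x : shift_space G K => h (b \o x)).
Proof.
move=> mb lh c; have [|S hS] := @local_window A T (fun z => h z == c).
  by move=> z z' /lh ->.
rewrite (_ : _ @^-1` _ = (fun x : shift_space G K => window T (b \o x)) @^-1` [set` S]).
  apply: fmeasurable_preimage; exact: fmeasurable_window.
by apply/seteqP; split => x /=; [move/eqP; rewrite hS|move=> Sx; apply/eqP; rewrite hS].
Qed.

Context (R : realType) (kappa : probability K R)
  (mu : probability (shift_space G K) R).
Hypothesis mu_prod : is_product_measure kappa mu.

Lemma measure_window (A : finType) T (b : K -> A) (l : {ffun 'I_(size T) -> A}) :
  uniq T -> fmeasurable b ->
  mu [set x | window T (b \o x) = l] =
  (\prod_i fine (kappa (b @^-1` [set l i])))%:E.
Proof.
move=> uT mb.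
rewrite (_ : mkset _ =
  [set x : shift_space G K | forall i, (b @^-1` [set l i]) (x (tnth (in_tuple T) i))]).
  rewrite (mu_prod (As := fun i => b @^-1` [set l i]))//; last exact: tnth_inj.
  rewrite -prodEFin; apply: eq_bigr => i _; exact/esym/fine_measureK.
apply/seteqP; split => [x /= <- i|x H]; first by rewrite ffunE.
by apply/ffunP => i; rewrite ffunE; exact: H.
Qed.

(* The local statistics of the shift are those of an i.i.d. labelling of any
   finite set along any injective placement of the window. *)
Lemma measure_local (A V : finType) T (b : K -> A) (P : (gcar G -> A) -> bool)
    (J : gcar G -> V) :
  fmeasurable b -> local T P -> {in T &, injective J} ->
  mu [set x | P (b \o x)] =
  (\sum_(w : {ffun V -> A})
    (\prod_v fine (kappa (b @^-1` [set w v]))) * (P (w \o J))%:R)%:E.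
Proof.
move=> mb lP Jinj.
(* The product formula needs distinct sites, hence a window without repetitions. *)
have {}lP : local (undup T) P by apply: sub_local lP => t; rewrite mem_undup.
have {}Jinj : {in undup T &, injective J}.
  by move=> s t; rewrite !mem_undup; exact: Jinj.
have := undup_uniq T; move: (undup T) lP Jinj => {}T lP Jinj uT.
have [S PS] := local_window lP.
rewrite (_ : mkset _ = (fun x : shift_space G K => window T (b \o x)) @^-1` [set` S]);
  last by apply/seteqP; split => x /=; rewrite PS.
rewrite measure_fpreimage; last exact: fmeasurable_window.
under eq_bigr => l _ do rewrite (measure_window l uT mb).
rewrite sumEFin; congr EFin.
under [RHS]eq_bigr => w _.
  rewrite PS (_ : window T (w \o J) = [ffun i => w (J (tnth (in_tuple T) i))]) //.
  over.
rewrite (sum_prod_marginal (p := fun a => fine (kappa (b @^-1` [set a])))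
  (fun l => (S l)%:R)).
- by rewrite big_mkcond; apply: eq_bigr => l _; case: ifP; rewrite ?mulr1 ?mulr0.
- move=> i j /Jinj; rewrite !mem_tnth => /(_ isT isT).
  exact: tnth_inj.
- apply: EFin_inj; rewrite -sumEFin.
  transitivity (kappa (b @^-1` [set` predT])).
    by rewrite measure_fpreimage//; apply: eq_bigr => a _; rewrite fine_measureK.
  by rewrite set_true preimage_setT probability_setT.
Qed.


Lemma shift_measurable (g : gcar G) (E : set (shift_space G K)) :
  measurable E -> measurable ((Defs.shift g : shift_space G K -> shift_space G K) @^-1` E).
Proof.
move=> mE; rewrite -[X in measurable X]setTI.
suff H : measurable_fun setT (Defs.shift g : shift_space G K -> shift_space G K) by exact: H.
apply: (@measurability _ _ (shift_space G K) (shift_space G K) setT _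
  (@cylinders G d K)) => //.
move=> _ [_ [f [D [mD ->]]] <-]; rewrite setTI.
exact: measurable_coord.
Qed.

(** The measure and its image under the shift agree on finite cylinders, since translating the sites
    keeps them distinct and leaves the product unchanged. Finite cylinders form a generating family
    closed under intersection, which determines a probability. *)
Lemma measure_shift (g : gcar G) (E : set (shift_space G K)) : measurable E ->
  mu ((Defs.shift g : shift_space G K -> shift_space G K) @^-1` E) = mu E.
Proof.
(* The constraint [D] is defined at every group element and trivial off [T], so that two cylinders
   with different windows intersect coordinatewise. *)
pose C : set (set (shift_space G K)) := [set E | exists (T : seq (gcar G))
  (D : gcar G -> set K), [/\ uniq T, forall g, measurable (D g),
    (forall g, g \notin T -> D g = setT) & E = [set x | forall g, D g (x g)]]].
have CE (T : seq (gcar G)) (D : gcar G -> set K) (x : gcar G -> K) :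
    (forall g, g \notin T -> D g = setT) ->
    (forall g, D g (x g)) <->
    (forall i, D (tnth (in_tuple T) i) (x (tnth (in_tuple T) i))).
  move=> DT; split => [H i|H f]; first exact: H.
  by have [/seq_tnthP[i ->]|/DT ->] := boolP (f \in T).
have mshift : measurable_fun setT (Defs.shift g : shift_space G K -> shift_space G K).
  by move=> _ Y mY; rewrite setTI; exact: shift_measurable.
pose m2 : {measure set (shift_space G K) -> \bar R} :=
  pushforward mu (Defs.shift g : shift_space G K -> shift_space G K).
have mC : measurable = <<s C >>.
  apply/seteqP; split.
    apply: smallest_sub; first exact: smallest_sigma_algebra.
    move=> _ [f [D [mD ->]]]; apply: sub_sigma_algebra.
    exists [:: f], (fun g => if g == f then D else setT); split => //.
    - by move=> h; case: ifP.
    - by move=> h; rewrite inE => /negbTE ->.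
    - apply/seteqP; split => x /= Dx; last by have := Dx f; rewrite eqxx.
      by move=> h; case: eqP => // ->.
  apply: smallest_sub; first exact: smallest_sigma_algebra.
  move=> _ [T [D [uT mD DT ->]]].
  rewrite (_ : mkset _ = \bigcap_(i in [set: 'I_(size T)])
    [set x : shift_space G K | D (tnth (in_tuple T) i) (x (tnth (in_tuple T) i))]).
    by apply: fin_bigcap_measurable => // i _; exact: measurable_coord.
  by apply/seteqP; split => x /=;
    [move/(CE T D x DT) => H i _|move=> H; apply/(CE T D x DT) => i]; exact: H.
move=> mE; suff : mu E = m2 mshift E by move=> ->.
apply: (measure_unique C (fun=> setT) mC _ _ _ mu (m2 mshift)) => //.
- move=> _ _ [T [D [uT mD DT ->]]] [T' [D' [uT' mD' DT' ->]]].
  exists (undup (T ++ T')), (fun g => D g `&` D' g); split => //.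
  + exact: undup_uniq.
  + by move=> f; exact: measurableI.
  + move=> f; rewrite mem_undup mem_cat negb_or => /andP[fT fT'].
    by rewrite DT// DT'// setIT.
  + apply/seteqP; split => x /=; first by move=> [H H'] f; split.
    by move=> H; split => f; have [] := H f.
- by move=> _; exists [::], (fun=> setT); split => //; apply/seteqP; split.
- by rewrite bigcup_const//; exists 0%N.
- move=> _ [T [D [uT mD DT ->]]]; rewrite /m2 /= /pushforward.
  rewrite (_ : mkset _ = [set x : shift_space G K | forall i : 'I_(size T),
     D (tnth (in_tuple T) i) (x (tnth (in_tuple T) i))]); last first.
    by apply/seteqP; split => x /= /(CE T D x DT).
  rewrite (_ : _ @^-1` _ = [set x : shift_space G K | forall i : 'I_(size T),
     D (tnth (in_tuple T) i) (x (gmul (ginv g) (tnth (in_tuple T) i)))]) //.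
  rewrite !(mu_prod (As := fun i => D (tnth (in_tuple T) i)))//.
    by move=> i j /gmulI; exact: tnth_inj.
  exact: tnth_inj.
- by move=> _; apply: (le_lt_trans (probability_le1 mu measurableT)); rewrite ltry.
Qed.

End window.

(** Bundles the alphabet, quotient, window and rule, so that one can be selected for each value of a
    finite map by [choice]. *)
Record block_code (G : cgroup) (K C : Type) := BlockCode {
  alphabet : finType;
  letter : K -> alphabet;
  support : seq (gcar G);
  rule : (gcar G -> alphabet) -> C }.

(** * Approximation of measurable maps by local rules *)

Section approximation.
Variables (G : cgroup) (d : measure_display) (K : measurableType d).
Variables (R : realType) (mu : probability (shift_space G K) R).

(** The finite quotient [b] may depend on [e], as [K] itself can be infinite. *)
Definition approximable (C : finType) (f : shift_space G K -> C) :=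
  forall e : R, 0 < e -> exists (A : finType) (b : K -> A) (T : seq (gcar G))
    (h : (gcar G -> A) -> C),
  [/\ fmeasurable b, local T h &
      (mu [set x | h (b \o x) != f x] <= e%:E)%E].

Let app (E : set (shift_space G K)) := approximable (fun x => `[< E x >]).

Lemma fmeasurable_asbool (E : set (shift_space G K)) : measurable E ->
  fmeasurable (fun x => `[< E x >]).
Proof.
move=> mE [].
  by rewrite (_ : _ @^-1` _ = E)//; apply/seteqP; split => x /= /asboolP.
rewrite (_ : _ @^-1` _ = ~` E); first exact: measurableC.
by apply/seteqP; split => x /=; [move/negbT/asboolPn|exact: asboolF].
Qed.

(** Both rules run side by side on the product alphabet and the concatenated window; the disjunction
    errs only where one of them does. *)
Lemma approximableU E F : measurable E -> measurable F ->
  app E -> app F -> app (E `|` F).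
Proof.
move=> mE mF aE aF e e0; have e20 : 0 < e / 2 by rewrite divr_gt0.
have [A [b [T [h [mb lh he]]]]] := aE _ e20.
have [A' [b' [T' [h' [mb' lh' he']]]]] := aF _ e20.
exists (A * A')%type, (fun k => (b k, b' k)), (T ++ T'),
  (fun z => h (fst \o z) || h' (snd \o z)).
have lH : local (T ++ T') (fun z : gcar G -> A * A' => h (fst \o z) || h' (snd \o z)).
  move=> z z' zz'; congr (_ || _); [apply: lh|apply: lh'] => t tT /=;
    by rewrite zz'// mem_cat tT ?orbT.
have mB := fmeasurable_pair mb mb'.
split => //.
have m1 : measurable [set x : shift_space G K | h (b \o x) != `[< E x >]].
  by apply: fmeasurable_neq; [exact: fmeasurable_local lh|exact: fmeasurable_asbool].
have m2 : measurable [set x : shift_space G K | h' (b' \o x) != `[< F x >]].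
  by apply: fmeasurable_neq; [exact: fmeasurable_local lh'|exact: fmeasurable_asbool].
rewrite [e]splitr EFinD; apply: le_trans (leeD he he').
apply: le_trans (measureU2 mu m1 m2); apply: le_measure; rewrite ?inE.
- apply: fmeasurable_neq; first exact: (fmeasurable_local mB lH).
  by apply: fmeasurable_asbool; exact: measurableU.
- exact: measurableU.
- move=> x /=; rewrite asbool_or => H; apply/orP; move: H; apply: contraNT.
  by rewrite negb_or !negbK => /andP[/eqP <- /eqP <-].
Qed.

(** The approximable measurable sets form a sigma-algebra containing the cylinders, which are
    themselves local. Measurability is carried along in the induction because the union step bounds
    measures of error sets. *)
Lemma approximable_set E : measurable E -> app E.
Proof.
move: E; suff H : measurable `<=` [set E | measurable E /\ app E] by move=> E /H[].
apply: smallest_sub; last first.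
  move=> _ [g [D [mD ->]]]; split; first exact: measurable_coord.
  move=> e e0; exists bool, (fun k => `[< D k >]), [:: g], (fun z => z g); split.
  - case; first by rewrite (_ : _ @^-1` _ = D)//; apply/seteqP; split => x /= /asboolP.
    rewrite (_ : _ @^-1` _ = ~` D); first exact: measurableC.
    by apply/seteqP; split => x /=; [move/negbT/asboolPn|exact: asboolF].
  - by move=> z z'; apply; rewrite inE.
  - rewrite (_ : mkset _ = set0) ?measure0 ?lee_fin ?ltW//.
    by apply/seteqP; split => x //=; rewrite eqxx.
have app0 : app set0.
  move=> e e0; exists unit, (fun=> tt), [::], (fun=> false); split => //.
  - by case; rewrite (_ : _ @^-1` _ = setT)//; apply/seteqP.
  - rewrite (_ : mkset _ = set0) ?measure0 ?lee_fin ?ltW//.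
    by apply/seteqP; split => x //=; rewrite asboolF.
have appU (E : (set (shift_space G K))^nat) :
    (forall n, measurable (E n) /\ app (E n)) ->
    measurable (\bigcup_k E k) /\ app (\bigcup_k E k).
  move=> aE; have mE n : measurable (E n) by have [] := aE n.
  split; first exact: bigcup_measurable.
  have aU n : app (\big[setU/set0]_(i < n) E i).
    elim: n => [|n IH]; first by rewrite big_ord0.
    rewrite big_ord_recr /=; apply: approximableU => //.
      by apply: bigsetU_measurable.
    by have [] := aE n.
  move=> e e0; have e20 : 0 < e / 2 by rewrite divr_gt0.
  (* [F n] is what the first [n] sets miss. It decreases to the empty set, so half of the error
     budget covers it for some [n] and the other half goes to the finite union. *)
  pose F n := (\bigcup_k E k) `\` \big[setU/set0]_(i < n) E i.
  have mF n : measurable (F n).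
    by apply: measurableD; [exact: bigcup_measurable|exact: bigsetU_measurable].
  have cF : mu \o F @ \oo --> 0%E.
    rewrite -(measure0 mu) -(_ : \bigcap_n F n = set0).
      apply: nonincreasing_cvg_mu => //.
      - by rewrite (le_lt_trans (probability_le1 _ _))// ltry.
      - exact: bigcap_measurable.
      - move=> n m nm; apply/subsetPset; apply: setDS.
        exact: subset_bigsetU.
    apply/seteqP; split => x // H; have [[k _ Ek] _] := H 0%N I.
    have [_ []] := H k.+1 I; rewrite -bigcup_mkord.
    by exists k => //=.
  have [n Fn] : exists n, (mu (F n) <= (e / 2)%:E)%E.
    have /fine_cvgP[_ /cvgrPdist_le /(_ _ e20) [n _ /(_ n (leqnn n)) /=]] := cF.
    rewrite sub0r normrN ger0_norm ?fine_ge0// => H.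
    by exists n; rewrite -fine_measureK// lee_fin.
  have [A [b [T [h [mb lh he]]]]] := aU n _ e20.
  exists A, b, T, h; split => //.
  have m1 : measurable [set x : shift_space G K | h (b \o x) != `[< (\big[setU/set0]_(i < n) E i) x >]].
    apply: fmeasurable_neq; first exact: fmeasurable_local lh.
    by apply: fmeasurable_asbool; exact: bigsetU_measurable.
  rewrite [e]splitr EFinD; apply: le_trans (leeD he Fn).
  apply: le_trans (measureU2 mu m1 (mF n)); apply: le_measure; rewrite ?inE.
  + apply: fmeasurable_neq; first exact: (fmeasurable_local mb lh).
    by apply: fmeasurable_asbool; exact: bigcup_measurable.
  + exact: measurableU.
  + move=> x /= hx; have [Ex|Ex] := pselect ((\big[setU/set0]_(i < n) E i) x).
      left; move: hx; rewrite (asboolT Ex) asboolT//.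
      by move: Ex; rewrite -bigcup_mkord => -[k _ Ek]; exists k.
    have [Fx|Fx] := pselect ((\bigcup_k E k) x); first by right.
    by left; move: hx; rewrite !asboolF.
split.
- by split.
- move=> E [mE aE]; split; first by rewrite setTD; exact: measurableC.
  move=> e e0; have [A [b [T [h [mb lh he]]]]] := aE _ e0.
  exists A, b, T, (fun z => ~~ h z); split => //; first by move=> z z' /lh ->.
  rewrite (_ : mkset _ = [set x | h (b \o x) != `[< E x >]])//.
  have EC x : `[< (setT `\` E) x >] = ~~ `[< E x >] by rewrite setTD asbool_neg.
  by apply/seteqP; split => x; rewrite /mkset EC; case: (h _); case: `[< _ >].
- exact: appU.
Qed.

(** Each event [f x = c] is approximated within [e / #|C|], and the rule picks a [c] whose test
    accepts. Where all the tests are right, [f x] is the only accepted value, so a union bound over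
    [C] suffices. *)
Lemma fmeasurable_approximable (C : finType) (f : shift_space G K -> C) :
  fmeasurable f -> approximable f.
Proof.
move=> mf e e0.
(* The default value when no test accepts; it exists because a probability space is nonempty. *)
have [c0 _] : exists c0 : C, True.
  have [T0|/set0P[x _]] := eqVneq [set: shift_space G K] set0; last by exists (f x).
  have := probability_setT mu; rewrite T0 measure0 => /eqP.
  by rewrite eq_sym onee_eq0.
have C0 : 0 < #|C|%:R :> R by rewrite ltr0n; apply/card_gt0P; exists c0.
have H c : exists D : block_code G K bool,
  [/\ fmeasurable (letter D), local (support D) (@rule _ _ _ D) &
     (mu [set x | rule (letter D \o x) != (f x == c)] <= (e / #|C|%:R)%:E)%E].
  have [|A [b [T [h [mb lh he]]]]] := @approximable_set _ (mf c) (e / #|C|%:R).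
    by rewrite divr_gt0.
  exists (BlockCode b T h); split => //=.
  rewrite (_ : mkset _ = [set x | h (b \o x) != `[< (f @^-1` [set c]) x >]])//.
  apply/seteqP; split => x /=;
    by rewrite (_ : `[< f x = c >] = (f x == c)) //; apply/asboolP/eqP.
have [D HD] := choice H.
pose A := {dffun forall c, alphabet (D c)}.
pose b k : A := [ffun c => letter (D c) k].
pose h (z : gcar G -> A) :=
  odflt c0 [pick c | @rule _ _ _ (D c) (fun g => z g c)].
pose T := flatten [seq support (D c) | c <- enum C].
have mb : fmeasurable b by apply: fmeasurable_ffun => c; have [] := HD c.
have lh : local T h.
  move=> z z' zz'; rewrite /h; congr (odflt _ _); apply: eq_pick => c.
  have [_ lc _] := HD c; apply: lc => t tc; rewrite zz'//.
  by apply/flatten_mapP; exists c; rewrite ?mem_enum.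
exists A, b, T, h; split => //.
rewrite (_ : e = #|C|%:R * (e / #|C|%:R)); last by rewrite mulrC divfK ?gt_eqF.
apply: (measure_bigU_le (F := fun c =>
  [set x : shift_space G K | rule (letter (D c) \o x) != (f x == c)])).
- move=> c; have [mc lc _] := HD c.
  apply: fmeasurable_neq; first exact: fmeasurable_local lc.
  exact: (fmeasurable_comp (fun y => y == c) mf).
- by apply: fmeasurable_neq => //; exact: fmeasurable_local lh.
- move=> x /= hx; apply: contrapT => nx; move/negP: hx; apply.
  have hc c : rule (letter (D c) \o x) = (f x == c).
    apply/eqP; apply: contrapT => /negP nc; apply: nx; exists c => //.
  rewrite /h; case: pickP => [c|/(_ (f x))].
    rewrite (_ : (fun g => _) = letter (D c) \o x) ?hc => [/eqP ->//|].
    by apply/funext => g /=; rewrite ffunE.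
  rewrite (_ : (fun g => _) = letter (D (f x)) \o x) ?hc ?eqxx//.
  by apply/funext => g /=; rewrite ffunE.
- by move=> c; have [] := HD c.
Qed.

End approximation.

(** * Entropy of finite partitions *)

Section mixture.
Variables (R : realType) (A : finType) (eta : R).
Hypothesis eta01 : 0 < eta < 1.

(* Adding a uniform part keeps [ln (mix P a)] bounded independently of [P]. *)
Definition mix (P : A -> R) (a : A) : R := (1 - eta) * P a + eta / #|A|%:R.

Variable P : A -> R.
Hypotheses (P0 : forall a, 0 <= P a) (P1 : \sum_a P a = 1).

Let A0 : 0 < #|A|%:R :> R.
Proof.
rewrite ltr0n lt0n; apply/eqP => cA; have := P1.
rewrite big_pred0 => [/eqP|a]; first by rewrite eq_sym oner_eq0.
by have := fintype0 a cA.
Qed.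

Lemma mix_gt0 a : 0 < mix P a.
Proof.
have /andP[e0 e1] := eta01; rewrite ltr_wpDl ?divr_gt0// mulr_ge0// subr_ge0.
exact: ltW.
Qed.

Lemma sum_mix : \sum_a mix P a = 1.
Proof.
rewrite big_split /= -big_distrr /= P1 sumr_const -[X in _ + X]mulr_natr.
by rewrite divfK ?gt_eqF// mulr1 subrK.
Qed.

Lemma mix_le1 a : mix P a <= 1.
Proof.
rewrite -sum_mix (bigD1 a) //= lerDl; apply: sumr_ge0 => b _.
exact/ltW/mix_gt0.
Qed.

Lemma mix_ln_ge0 a : 0 <= - ln (mix P a).
Proof. by rewrite oppr_ge0 ln_le0// mix_le1. Qed.

Lemma mix_ln_le a : - ln (mix P a) <= - ln (eta / #|A|%:R).
Proof.
have /andP[e0 e1] := eta01.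
rewrite lerN2 ler_ln ?posrE ?mix_gt0 ?divr_gt0// lerDr mulr_ge0// subr_ge0.
exact: ltW.
Qed.

Lemma mix_ln_bound_ge0 : 0 <= - ln (eta / #|A|%:R).
Proof.
have /andP[e0 e1] := eta01; rewrite oppr_ge0 ln_le0// ler_pdivrMr// mul1r.
by rewrite (le_trans (ltW e1))// ler1n -(ltr0n R).
Qed.

Lemma mix_ln_le_mul a : 0 < P a -> - ln (mix P a) <= - ln (1 - eta) - ln (P a).
Proof.
move=> Pa; have /andP[e0 e1] := eta01; have e2 : 0 < 1 - eta by rewrite subr_gt0.
rewrite -opprD lerN2 -lnM ?posrE// ler_ln ?posrE ?mulr_gt0 ?mix_gt0//.
by rewrite lerDl divr_ge0 ?ltW.
Qed.

(** Since [mix P a] is at least [(1 - eta) * P a], coding with the mixture costs at most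
    [- ln (1 - eta)] more than the entropy of [P]. *)
Lemma cross_entropy_mix :
  \sum_a P a * - ln (mix P a) <= \sum_a - (P a * ln (P a)) - ln (1 - eta).
Proof.
have <- : (\sum_a P a) * ln (1 - eta) = ln (1 - eta) by rewrite P1 mul1r.
rewrite big_distrl /= -sumrB; apply: ler_sum => a _.
have := P0 a; rewrite le_eqVlt => /predU1P[<-|Pa].
  by rewrite !mul0r oppr0 addr0.
by have := ler_wpM2l (ltW Pa) (mix_ln_le_mul Pa); lra.
Qed.

End mixture.

Section partition_entropy.
Context d (K : measurableType d) (R : realType) (kappa : probability K R).

Definition pmass (A : finType) (b : K -> A) a := fine (kappa (b @^-1` [set a])).

Definition partition_entropy (A : finType) (b : K -> A) : R :=
  \sum_a - (pmass b a * ln (pmass b a)).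

Lemma pmass_ge0 (A : finType) (b : K -> A) a : 0 <= pmass b a.
Proof. by rewrite fine_ge0. Qed.

Lemma sum_pmass (A : finType) (b : K -> A) : fmeasurable b ->
  \sum_a pmass b a = 1.
Proof.
move=> mb; apply: EFin_inj; rewrite -sumEFin.
transitivity (kappa (b @^-1` [set` predT])).
  by rewrite measure_fpreimage//; apply: eq_bigr => a _; rewrite fine_measureK.
rewrite (_ : _ @^-1` _ = setT) ?probability_setT//; exact/seteqP.
Qed.

Lemma pmass_comp (A B : finType) (b : K -> B) (c : B -> A) a : fmeasurable b ->
  pmass (c \o b) a = \sum_(i | c i == a) pmass b i.
Proof.
move=> mb; apply: EFin_inj; rewrite -sumEFin fine_measureK; last first.
  exact: fmeasurable_comp.
rewrite (_ : _ @^-1` _ = b @^-1` [set` [pred i | c i == a]]).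
  by rewrite measure_fpreimage//; apply: eq_bigr => i _; rewrite fine_measureK.
by apply/seteqP; split => x /=; rewrite inE => /eqP.
Qed.

Lemma pmass_le1 (A : finType) (b : K -> A) a : fmeasurable b -> pmass b a <= 1.
Proof. by move=> mb; rewrite -lee_fin fine_measureK// probability_le1. Qed.

Lemma xlnx_ge0 (x : R) : 0 <= x <= 1 -> 0 <= - (x * ln x).
Proof. by move=> /andP[x0 x1]; rewrite -mulrN mulr_ge0// oppr_ge0 ln_le0. Qed.

Hypothesis m1 : forall k : K, measurable [set k].

Let f k : \bar R := (- fine (kappa [set k]) * ln (fine (kappa [set k])))%:E.

Let f_ge0 k : (0 <= f k)%E.
Proof.
rewrite lee_fin mulNr xlnx_ge0// fine_ge0//=.
by rewrite -lee_fin fine_measureK// probability_le1.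
Qed.

Lemma entropy_ge0 : (0 <= entropy kappa)%E.
Proof. by rewrite /entropy; case: ifP => // _; apply: esum_ge0 => k _; exact: f_ge0. Qed.

(** A cell has at least the mass of each of its atoms, so splitting the cell into atoms and
    replacing its [- ln] by theirs can only increase the sum. Without a countable support the right
    side is [+oo]. *)
Lemma partition_entropy_le (A : finType) (b : K -> A) : fmeasurable b ->
  ((partition_entropy b)%:E <= entropy kappa)%E.
Proof.
move=> mb; rewrite /entropy; case: asboolP => [[S [cS [mS S0]]]|_]; last exact: leey.
have /countable_injP[j jinj] := cS.
(* The injection [j] of [S] into the naturals cuts each cell into pieces of at most one point, ready
   for countable additivity. *)
pose F a n := (S `&` b @^-1` [set a]) `&` j @^-1` [set n].
have F1 a n : F a n = set0 \/ exists2 k, F a n = [set k] & b k = a.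
  have [->|/set0P[k Fk]] := eqVneq (F a n) set0; [by left|right; exists k].
    apply/seteqP; split => [x [[Sx bx] jx]|x ->//].
    have [[Sk bk] jk] := Fk.
    by apply: jinj; rewrite ?inE// jx jk.
  by have [[]] := Fk.
have mF a n : measurable (F a n) by have [->|[k -> _]] := F1 a n.
have tF a : trivIset setT (F a) by move=> n m _ _ [x [[_ <-] [_ <-]]].
have UF a : \bigcup_n F a n = S `&` b @^-1` [set a].
  by apply/seteqP; split => [x [n _ []]//|x Sx]; exists (j x).
have step a : ((- (pmass b a * ln (pmass b a)))%:E <=
    \esum_(k in S `&` b @^-1` [set a]) f k)%E.
  have c0 : 0 <= - ln (pmass b a) by rewrite oppr_ge0 ln_le0// pmass_le1.
  rewrite -mulrN EFinM fine_measureK//.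
  rewrite (_ : kappa _ = kappa (S `&` b @^-1` [set a])); last first.
    apply/eqP; rewrite eq_le; apply/andP; split; last first.
      by apply: le_measure; rewrite ?inE//; exact: measurableI.
    rewrite -[leRHS]adde0 -S0.
    apply: le_trans (measureU2 _ _ _); [|exact: measurableI|exact: measurableC].
    apply: le_measure; rewrite ?inE//.
      by apply: measurableU; [exact: measurableI|exact: measurableC].
    by move=> x bx; have [Sx|Sx] := pselect (S x); [left|right].
  rewrite -UF measure_bigcup//= esum_bigcupT//.
  rewrite muleC -nneseriesZl// nneseries_esum; last by move=> n _; rewrite mule_ge0 ?lee_fin.
  rewrite set_mem_set; apply: le_esum => n _.
  have [->|[k -> bk]] := F1 a n; first by rewrite measure0 mule0 esum_set0.
  rewrite esum_set1// -[kappa [set k]]fine_measureK// -EFinM lee_fin.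
  have := fine_ge0 (measure_ge0 kappa [set k]); rewrite le_eqVlt => /predU1P[e|k0].
    by rewrite -e mulr0 oppr0 mul0r.
  rewrite mulrC mulNr -mulrN ler_pM2l// lerN2 ler_ln ?posrE//.
    rewrite -lee_fin !fine_measureK//; apply: le_measure; rewrite ?inE//.
    by move=> x ->.
  apply: lt_le_trans k0 _.
  rewrite -lee_fin !fine_measureK//; apply: le_measure; rewrite ?inE//.
  by move=> x ->.
rewrite /partition_entropy -sumEFin; apply: le_trans (lee_sum _ (fun a _ => step a)) _.
under eq_bigr do rewrite esum_mkcond.
rewrite -esum_sum => [|k a _ _]; last by case: ifP => // _; exact: f_ge0.
(* Each point is counted at most once, in the cell [b k]. *)
apply: le_esum => k _; rewrite (bigD1 (b k))//= big1 ?adde0 => [|a ak].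
  by case: ifP => // _; exact: f_ge0.
case: ifP => //; rewrite inE => -[_ /= e].
by rewrite e eqxx in ak.
Qed.

(** A finite partial sum of the entropy series is the entropy of the partition into those points and
    the rest, up to the nonnegative term of the rest. *)
Lemma entropy_le (L : \bar R) :
  (exists S : set K, countable S /\ measurable S /\ kappa (~` S) = 0%E) ->
  (forall (A : finType) (b : K -> A), fmeasurable b ->
    ((partition_entropy b)%:E <= L)%E) ->
  (entropy kappa <= L)%E.
Proof.
move=> cS H; rewrite /entropy asboolT//; apply: ub_ereal_sup => _ [F [finF _] <-].
rewrite fsbig_finite//=; move: (finmap.enum_fset (fset_set F)) (finmap.fset_uniq (fset_set F)) => s us.
(* Off [s] the index is [size s], so the last letter is the remainder cell. *)
pose b k : 'I_(size s).+1 := inord (index k s).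
have bE (i : 'I_(size s)) : b @^-1` [set widen_ord (leqnSn _) i] =
    [set tnth (in_tuple s) i].
  apply/seteqP; split => k /=.
    move=> /(congr1 val) /=; rewrite inordK ?ltnS ?index_size// => e.
    by rewrite (tnth_nth k) /= -e nth_index// -index_mem e.
  move=> ->; apply: val_inj; rewrite /= inordK ?ltnS ?index_size//.
  by rewrite (tnth_nth (tnth (in_tuple s) i)) /= index_uniq.
have mb : fmeasurable b.
  move=> i; have [lt_i|ge_i] := ltnP i (size s).
    rewrite (_ : i = widen_ord (leqnSn _) (Ordinal lt_i)) ?bE//.
    exact: val_inj.
  rewrite (_ : _ @^-1` _ = ~` \bigcup_(l in [set: 'I_(size s)]) [set tnth (in_tuple s) l]).
    by apply: measurableC; apply: fin_bigcup_measurable.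
  apply/seteqP; split => k /=.
    move=> /(congr1 val) /=; rewrite inordK ?ltnS ?index_size// => e [l _ /= kl].
    have : (index k s < size s)%N by rewrite index_mem kl mem_tnth.
    by rewrite e ltnNge ge_i.
  move=> nk; apply: val_inj; rewrite /= inordK ?ltnS ?index_size//.
  apply/eqP; rewrite eqn_leq (leq_trans (index_size _ _) ge_i)/=.
  have -> : nat_of_ord i = size s.
    by apply/eqP; rewrite eqn_leq ge_i -ltnS ltn_ord.
  rewrite leqNgt index_mem; apply/negP => /seq_tnthP[l kl]; apply: nk.
  by exists l.
apply: le_trans (H _ b mb).
rewrite sumEFin lee_fin /partition_entropy big_ord_recr /=.
rewrite -[leLHS]addr0 lerD//; last first.
  by rewrite xlnx_ge0// pmass_ge0 pmass_le1.
rewrite big_tnth; apply: ler_sum => i _.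
by rewrite /pmass bE mulNr.
Qed.

End partition_entropy.

(** * Labellings of a sofic approximation *)

Section labelling.
Variables (R : realType) (G : cgroup) (d : measure_display).
Variables (K : measurableType d) (kappa : probability K R).
Variable mu : probability (shift_space G K) R.
Hypothesis mu_prod : is_product_measure kappa mu.
Variables (A A1 B V : finType) (g : K -> B) (c : B -> A).
Variables (h1 : (gcar G -> A1) -> A) (T1 : seq (gcar G)).
Variables (h2 : (gcar G -> B) -> A1) (T2 : seq (gcar G)).
Hypotheses (mg : fmeasurable g) (lh1 : local T1 h1) (lh2 : local T2 h2).
Variables (Phi : gcar G -> gcar G) (sigma : gcar G -> V -> V).
Hypothesis sigma_inj : forall t, injective (sigma t).

Let W (w : {ffun V -> B}) := \prod_v pmass kappa g (w v).

(* [fun f => w (sigma (ginv f) v)] is the configuration on [G] seen from [v]: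
   moving from [v] to [sigma s v] shifts it by [s]. *)
Definition label1 (w : {ffun V -> B}) : {ffun V -> A1} :=
  [ffun v => h2 (fun f => w (sigma (ginv f) v))].

Definition label2 (u : {ffun V -> A1}) : {ffun V -> A} :=
  [ffun v => h1 (fun e => u (sigma (ginv (Phi e)) v))].

(* The group elements at which [sigma] has to be exact. *)
Definition label_support : seq (gcar G) :=
  gone G :: [seq ginv t | t <- T2] ++ [seq ginv (Phi e) | e <- T1] ++
  [seq ginv (gmul (Phi e) f) | e <- T1, f <- T2].

(** The first condition lets two successive local rules be read as one at products of group
    elements; the second sends distinct window sites to distinct vertices, hence to independent
    letters. *)
Definition good_vertex (v : V) :=
  {in label_support &, forall s t, sigma s (sigma t v) = sigma (gmul s t) v} /\
  {in label_support &, injective (sigma^~ v)}.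

(** The shift-space counterpart of a wrong letter in [label2 (label1 w)]. *)
Definition decoding_error := [set y : shift_space G K |
  h1 (fun e => h2 (fun f => g (y (gmul (Phi e) f)))) != c (g (y (gone G)))].

Let W_ge0 w : 0 <= W w.
Proof. by apply: prodr_ge0 => v _; exact: pmass_ge0. Qed.

Let sum_W : \sum_w W w = 1.
Proof. exact: (sum_prod_ffun1 (q := fun=> pmass kappa g) (fun=> sum_pmass kappa mg)). Qed.

Lemma expect_local T (P : (gcar G -> B) -> bool) (J : gcar G -> V) :
  local T P -> {in T &, injective J} ->
  \sum_(w : {ffun V -> B}) W w * (P (w \o J))%:R = fine (mu [set y | P (g \o y)]).
Proof. by move=> lP Jinj; rewrite (measure_local mu_prod mg lP Jinj). Qed.

Lemma expect_le (F : {ffun V -> B} -> R) M : (forall w, F w <= M) ->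
  \sum_w W w * F w <= M.
Proof.
move=> FM; rewrite -[leRHS]mul1r -sum_W big_distrl /=.
by apply: ler_sum => w _; exact: ler_wpM2l.
Qed.

(** Seen from a good vertex, the window [T2] is placed injectively, so [label1 w v] has the law of
    [h2] on the shift space. *)
Lemma expect_label1 (F : A1 -> R) v : good_vertex v ->
  \sum_(w : {ffun V -> B}) W w * F (label1 w v) =
  \sum_a fine (mu [set y | h2 (g \o y) == a]) * F a.
Proof.
move=> [_ vinj].
have Jinj : {in T2 &, injective (fun t => sigma (ginv t) v)}.
  move=> s t sT tT /vinj e; apply: ginv_inj; apply: e;
    by rewrite inE mem_cat map_f ?orbT.
rewrite (partition_big (fun w => label1 w v) predT) //=; apply: eq_bigr => a _.
rewrite -(@expect_local T2 (fun z => h2 z == a) (fun t => sigma (ginv t) v))//.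
  rewrite big_distrl /= big_mkcond /=; apply: eq_bigr => w _.
  have -> : (h2 (w \o (fun t => sigma (ginv t) v)) == a) = (label1 w v == a).
    by rewrite ffunE.
  by case: eqP => [->|_]; rewrite ?mulr1 // mulr0 mul0r.
by move=> z z' /lh2 ->.
Qed.

(** At a good vertex the two-stage reading visits [sigma (ginv f) (sigma (ginv (Phi e)) v)], which
    is [sigma (ginv (gmul (Phi e) f)) v]. The error is therefore a single local event over the
    window [T], placed injectively. *)
Lemma expect_label2 v : good_vertex v ->
  \sum_(w : {ffun V -> B}) W w * (label2 (label1 w) v != c (w v))%:R =
  fine (mu decoding_error).
Proof.
move=> [vM vinj].
pose J t := sigma (ginv t) v.
pose T := gone G :: [seq gmul (Phi e) f | e <- T1, f <- T2].
have invT t : t \in T -> ginv t \in label_support.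
  rewrite inE => /predU1P[->|/allpairsP[[e f] /= [eT fT ->]]].
    by rewrite ginv1 inE eqxx.
  rewrite inE !mem_cat; apply/orP; right; apply/orP; right; apply/orP; right.
  by apply/allpairsP; exists (e, f).
have Jinj : {in T &, injective J}.
  move=> s t /invT sT /invT tT /vinj e; apply: ginv_inj; exact: e.
pose P (z : gcar G -> B) :=
  h1 (fun e => h2 (fun f => z (gmul (Phi e) f))) != c (z (gone G)).
rewrite /decoding_error -[mkset _]/[set y : shift_space G K | P (g \o y)].
rewrite -(expect_local (T := T) (J := J))//; last first.
  move=> z z' zz'; rewrite /P (zz' (gone G)) ?inE ?eqxx//.
  congr (_ != _); apply: lh1 => e eT; apply: lh2 => f fT; apply: zz'.
  by rewrite inE; apply/orP; right; apply/allpairsP; exists (e, f).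
apply: eq_bigr => w _; congr (_ * (nat_of_bool _)%:R); rewrite /P /label2 ffunE.
congr (_ != c (w _)).
  apply: lh1 => e eT; rewrite ffunE; apply: lh2 => f fT /=.
  rewrite /J ginvM vM//.
    by rewrite inE mem_cat map_f ?orbT.
  by rewrite inE !mem_cat [_ \in map _ T1]map_f ?orbT.
(* [sigma] need not be a homomorphism, but exactness at [v] gives that applying [sigma (gone G)]
   twice equals applying it once; injectivity then shows that it fixes [v]. *)
rewrite /J /= ginv1; apply/esym/(@sigma_inj (gone G)).
by rewrite vM ?gmul1// inE eqxx.
Qed.

Variables (eta : R) (P1 : A1 -> R) (e1 e2 : R).
Hypotheses (eta01 : 0 < eta < 1) (e2_ge0 : 0 <= e2) (P1_ge0 : forall a, 0 <= P1 a).
Hypothesis sum_P1 : \sum_a P1 a = 1.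
Hypothesis label1_law : forall a, fine (mu [set y | h2 (g \o y) == a]) <= P1 a + e2.
Hypothesis error_le : fine (mu decoding_error) <= e1.

Let B1 := - ln (eta / #|A1|%:R).
Let B2 := - ln (eta / #|A|%:R).

(** Apply [coding_entropy_bound] with [q1] the smoothed [P1] and [q2 a] the smoothed point mass at
    the decoded letter [a]. Good vertices are charged through the shift-space statistics; any other
    vertex costs at most [B1 + B2], thanks to the smoothing. *)
Lemma coding_bound (good : pred V) : (forall v, good v -> good_vertex v) ->
  #|V|%:R * partition_entropy kappa (c \o g) <=
  #|V|%:R * (\sum_a - (P1 a * ln (P1 a)) - ln (1 - eta) *+ 2 +
    #|A1|%:R * B1 * e2 + B2 * e1) + #|predC good|%:R * (B1 + B2).
Proof.
move=> goodP.
pose dl (a b : A) : R := (a == b)%:R.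
have dl0 a b : 0 <= dl a b by rewrite /dl ler0n.
have dl1 a : \sum_b dl a b = 1.
  by rewrite (bigD1 a)//= /dl eqxx big1 ?addr0// => b; rewrite eq_sym => /negbTE ->.
have H := @coding_entropy_bound R V A A1 B (pmass kappa g) c label1 label2
  (pmass kappa (c \o g)) (mix eta P1) (fun a => mix eta (dl a))
  (pmass_ge0 kappa g) (sum_pmass kappa mg) (mix_gt0 eta01 P1_ge0 sum_P1)
  (sum_mix eta sum_P1) (fun a => mix_gt0 eta01 (dl0 a) (dl1 a))
  (fun a => sum_mix eta (dl1 a)) (fun a => pmass_comp kappa c a mg).
apply: le_trans H _.
set X := (X in _ * X + _).
have B1_ge0 : 0 <= B1 := mix_ln_bound_ge0 eta01 sum_P1.
have B2_ge0 : 0 <= B2.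
  exact: (mix_ln_bound_ge0 eta01 (sum_pmass kappa (fmeasurable_comp c mg))).
have e1_ge0 : 0 <= e1 by apply: le_trans error_le; rewrite fine_ge0.
have eta_ge0 : 0 <= - ln (1 - eta).
  by have /andP[e0 _] := eta01; rewrite oppr_ge0 ln_le0// gerBl ltW.
have X_ge0 : 0 <= X.
  rewrite /X -mulNrn !addr_ge0 ?mulr_ge0 ?mulrn_wge0 ?ler0n//.
  apply: sumr_ge0 => a _; rewrite xlnx_ge0// P1_ge0 -sum_P1 (bigD1 a)//= lerDl.
  exact: sumr_ge0.
have B1_ge : forall a, - ln (mix eta P1 a) <= B1 := mix_ln_le eta01 P1_ge0 sum_P1.
have L1_ge0 := mix_ln_ge0 eta01 P1_ge0 sum_P1.
have B2_ge a b : - ln (mix eta (dl a) b) <= B2 := mix_ln_le eta01 (dl0 a) (dl1 a) b.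
have L2_ge0 a b : 0 <= - ln (mix eta (dl a) b) := mix_ln_ge0 eta01 (dl0 a) (dl1 a) b.
have goodX v : good v -> \sum_(w : {ffun V -> B}) W w * - ln (mix eta P1 (label1 w v)) +
   \sum_(w : {ffun V -> B}) W w * - ln (mix eta (dl (label2 (label1 w) v)) (c (w v))) <= X.
  move=> /goodP gv.
  (* The excess [e2] in the mass of each of the [#|A1|] letters is charged at the maximal rate
     [B1]. *)
  have S1 : \sum_(w : {ffun V -> B}) W w * - ln (mix eta P1 (label1 w v)) <=
      \sum_a - (P1 a * ln (P1 a)) - ln (1 - eta) + #|A1|%:R * B1 * e2.
    rewrite (expect_label1 (fun a => - ln (mix eta P1 a)))//.
    apply: (@le_trans _ _ (\sum_a (P1 a + e2) * - ln (mix eta P1 a))).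
      by apply: ler_sum => a _; exact: ler_wpM2r.
    under eq_bigr do rewrite mulrDl.
    rewrite big_split /= lerD ?cross_entropy_mix//.
    rewrite -big_distrr /= mulrC; apply: ler_wpM2r => //.
    rewrite mulr_natl -sumr_const; exact: ler_sum.
  (* A correctly decoded letter costs at most [- ln (1 - eta)], and a wrong one at most [B2] on top
     of that. *)
  have S2 : \sum_(w : {ffun V -> B}) W w * - ln (mix eta (dl (label2 (label1 w) v)) (c (w v)))
     <= - ln (1 - eta) + B2 * e1.
    apply: (@le_trans _ _ (- ln (1 - eta) + B2 * fine (mu decoding_error))); last first.
      by rewrite lerD2l ler_wpM2l.
    rewrite -(expect_label2 gv) mulrC big_distrl /=.
    rewrite -[X in X + _]mul1r -[X in X * _ + _]sum_W big_distrl /= -big_split /=.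
    apply: ler_sum => w _; rewrite -mulrA -mulrDr ler_wpM2l//.
    have [->|_] := eqVneq (label2 (label1 w) v) (c (w v)); last by rewrite mul1r ler_wpDl.
    rewrite mul0r addr0.
    have := @mix_ln_le_mul R A eta eta01 (dl (c (w v))) (dl0 _) (dl1 _) (c (w v)).
    by rewrite /dl eqxx ltr01 ln1 subr0; exact.
  rewrite /X mulr2n; lra.
have allX v : \sum_(w : {ffun V -> B}) W w * - ln (mix eta P1 (label1 w v)) +
   \sum_(w : {ffun V -> B}) W w * - ln (mix eta (dl (label2 (label1 w) v)) (c (w v))) <= B1 + B2.
  by apply: lerD; apply: expect_le.
have -> : #|V|%:R * X + #|predC good|%:R * (B1 + B2) =
    \sum_v (X + (~~ good v)%:R * (B1 + B2)).
  rewrite big_split /= sumr_const mulr_natl -big_distrl /=; congr (_ + _ * _).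
  by rewrite -natr_sum -sum1_card big_mkcond.
apply: ler_sum => v _; have [gv|_] := boolP (good v).
  by rewrite mul0r addr0; exact: goodX.
by rewrite mul1r ler_wpDl//; exact: allX.
Qed.

End labelling.

(** * Transfer along a conjugacy *)

(** The sets [F i] increase to the whole group and [L] is finite, so some stage both contains [L]
    and has [eps i <= delta]. *)
Lemma sofic_good (R : realType) (G : cgroup) (L : seq (gcar G)) (delta : R) :
  sofic R G -> 0 < delta ->
  exists (m : nat) (sigma : gcar G -> {perm 'I_m}) (good : pred 'I_m),
  [/\ (0 < m)%N,
      forall v, good v ->
        {in L &, forall s t, sigma s (sigma t v) = sigma (gmul s t) v} /\
        {in L &, injective (fun t => sigma t v)} &
      #|predC good|%:R <= delta * m%:R].
Proof.
move=> [m [sigma [F [eps [m0 [_ [Fmono [FU [eps0 Fgood]]]]]]]]] delta0.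
have Fle i j : (i <= j)%N -> F i `<=` F j.
  move=> /subnKC <-; elim: (j - i)%N => [|k IH]; first by rewrite addn0.
  by rewrite addnS => x /IH /Fmono.
have [i0 Li0] : exists i0, forall t, t \in L -> F i0 t.
  elim: L => [|t L [i IH]]; first by exists 0%N.
  have [j _ Fj] : (\bigcup_i F i) t by rewrite FU.
  exists (maxn i j) => s; rewrite inE => /predU1P[->|/IH Fs].
    exact: Fle (leq_maxr _ _) _ Fj.
  exact: Fle (leq_maxl _ _) _ Fs.
have /cvgrPdist_le /(_ _ delta0) [i1 _ epsi1] := eps0.
pose i := maxn i0 i1.
have {}Li0 t : t \in L -> F i t by move=> /Li0; apply: Fle; exact: leq_maxl.
have epsi : eps i <= delta.
  have := epsi1 i (leq_maxr _ _); rewrite /= sub0r normrN.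
  exact: le_trans (ler_norm _).
have := Fgood i; set S := (X in #|X|) => cS.
exists (m i), (sigma i), (mem S); split => //.
- move=> v; rewrite inE /S /= => /asboolP [vM vinj]; split.
    by move=> s t /Li0 sL /Li0 tL; exact: vM.
  move=> s t /Li0 sL /Li0 tL e; apply: contrapT => st.
  exact: (vinj s t).
- have : #|S|%:R + #|predC (mem S)|%:R = (m i)%:R :> R.
    by rewrite -natrD cardC card_ord.
  have : eps i * (m i)%:R <= delta * (m i)%:R by rewrite ler_wpM2r.
  lra.
Qed.

(** Extends by a constant the letters of [phi] and [psi], which are controlled only on [X1] and
    [X2]. *)
Lemma fmeasurable_if d (T : measurableType d) (A : finType) (X : set T)
    (f : T -> A) (a0 : A) :
  measurable X -> (forall a, measurable (X `&` f @^-1` [set a])) ->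
  fmeasurable (fun x => if `[< X x >] then f x else a0).
Proof.
move=> mX mf a.
rewrite (_ : _ @^-1` _ = (X `&` f @^-1` [set a]) `|`
    (if a0 == a then ~` X else set0)).
  by apply: measurableU => //; case: ifP => // _; exact: measurableC.
apply/seteqP; split => x /=.
  by case: asboolP => Xx e; [left|right; rewrite e eqxx].
by case: asboolP => Xx [[]//|]; case: ifP => // /eqP.
Qed.

(** Used to choose tolerances; the [+ 1] guards against [C = 0]. *)
Lemma mul_div_succ_le (R : realType) (C e : R) : 0 <= C -> 0 <= e ->
  C * (e / (C + 1)) <= e.
Proof.
move=> C0 e0; have C1 : 0 < C + 1 by lra.
rewrite mulrA ler_pdivrMr// mulrC; apply: ler_wpM2l => //; lra.
Qed.

Section factor.
Variables (R : realType) (G : cgroup) (d1 d2 : measure_display).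
Variables (K1 : measurableType d1) (K2 : measurableType d2).
Variables (kappa1 : probability K1 R) (kappa2 : probability K2 R).
Variables (mu1 : probability (shift_space G K1) R).
Variables (mu2 : probability (shift_space G K2) R).
Hypothesis mu1_prod : is_product_measure kappa1 mu1.
Hypothesis mu2_prod : is_product_measure kappa2 mu2.
Hypothesis Gsofic : sofic R G.
Variables (Phi : gcar G -> gcar G).
Variables (X1 : set (shift_space G K1)) (X2 : set (shift_space G K2)).
Variables (phi : shift_space G K1 -> shift_space G K2).
Variables (psi : shift_space G K2 -> shift_space G K1).
Hypothesis PhiM : forall x y, Phi (gmul x y) = gmul (Phi x) (Phi y).
Hypotheses (mX1 : measurable X1) (mX2 : measurable X2) (X2_1 : mu2 X2 = 1%E).
Hypothesis phiX : forall x, X1 x -> X2 (phi x).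
Hypothesis psiX : forall y, X2 y -> X1 (psi y) /\ phi (psi y) = y.
Hypothesis mphi : forall E, measurable E -> E `<=` X2 ->
  measurable (X1 `&` phi @^-1` E).
Hypothesis mpsi : forall E, measurable E -> E `<=` X1 ->
  measurable (X2 `&` psi @^-1` E) /\ mu2 (X2 `&` psi @^-1` E) = mu1 E.
Hypothesis psi_shift : forall g y, X2 y ->
  X2 (Defs.shift (Phi g) y) /\ psi (Defs.shift (Phi g) y) = Defs.shift g (psi y).

Let Phi1 : Phi (gone G) = gone G.
Proof. by apply: (@gmulI _ (Phi (gone G))); rewrite -PhiM gmul1 gmulr1. Qed.

Let PhiV x : Phi (ginv x) = ginv (Phi x).
Proof. by apply: (@gmulI _ (Phi x)); rewrite -PhiM !gmulVr Phi1. Qed.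

Let mu_nX2 : mu2 (~` X2) = 0%E.
Proof. by rewrite probability_setC// X2_1 subee. Qed.

(** Only the letter at the identity is approximated; equivariance gives access to the others. *)
Let phi_letter (A : finType) (al : K2 -> A) x :=
  if `[< X1 x >] then al (phi x (gone G)) else al point.

Let psi_letter (A : finType) (be : K1 -> A) y :=
  if `[< X2 y >] then be (psi y (gone G)) else be point.

Let mphi_letter (A : finType) (al : K2 -> A) : fmeasurable al ->
  fmeasurable (phi_letter al).
Proof.
move=> mal; apply: fmeasurable_if => // a.
have -> : X1 `&` (fun x => al (phi x (gone G))) @^-1` [set a] =
    X1 `&` phi @^-1` (X2 `&` [set y | (al @^-1` [set a]) (y (gone G))]).
  by apply/seteqP; split => x /= [Xx]; [split=> //; split=> //; exact: phiX|case].
by apply: mphi => [|y []//]; apply: measurableI => //; exact: measurable_coord.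
Qed.

Let mpsi_letter_set (A : finType) (be : K1 -> A) a : fmeasurable be ->
  measurable (X2 `&` (fun y => be (psi y (gone G))) @^-1` [set a]) /\
  (mu2 (X2 `&` (fun y => be (psi y (gone G))) @^-1` [set a]) <=
   (pmass kappa1 be a)%:E)%E.
Proof.
move=> mbe.
pose E := [set x : shift_space G K1 | (be @^-1` [set a]) (x (gone G))].
have mE : measurable E by exact: measurable_coord.
have -> : X2 `&` (fun y => be (psi y (gone G))) @^-1` [set a] =
    X2 `&` psi @^-1` (X1 `&` E).
  apply/seteqP; split => x /= [Xx]; last by case.
  by split=> //; split=> //; have [] := psiX Xx.
have [|x []//|mXE ->] := mpsi (E := X1 `&` E); first exact: measurableI.
split=> //; rewrite fine_measureK//.
have <- : mu1 E = kappa1 (be @^-1` [set a]).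
  have := @mu1_prod 1 (fun=> gone G) (fun=> be @^-1` [set a]).
  rewrite big_ord1 => <-//; last by move=> [[]//] ? [[]//] ? _; exact: val_inj.
  by congr (mu1 _); apply/seteqP; split => [x Ex _//|x /(_ ord0)].
by apply: le_measure; rewrite ?inE//; exact: measurableI.
Qed.

Let mpsi_letter (A : finType) (be : K1 -> A) : fmeasurable be ->
  fmeasurable (psi_letter be).
Proof.
by move=> mbe; apply: fmeasurable_if => // a; have [] := mpsi_letter_set a mbe.
Qed.

(** If [h2] outputs [a], then the true letter of [psi y] is [a], or [h2] errs at [y], or [y] lies
    off the conull set [X2]. The first event has mass at most [pmass kappa1 be a], because [psi]
    preserves measure. *)
Lemma label1_law_le (A1 B : finType) (be : K1 -> A1) (g : K2 -> B) T2
    (h2 : (gcar G -> B) -> A1) (e2 : R) a :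
  fmeasurable be -> fmeasurable g -> local T2 h2 ->
  (mu2 [set y | h2 (g \o y) != psi_letter be y] <= e2%:E)%E ->
  fine (mu2 [set y | h2 (g \o y) == a]) <= pmass kappa1 be a + e2.
Proof.
move=> mbe mg lh2 he.
have [mS muS] := mpsi_letter_set a mbe.
have mh := fmeasurable_local mg lh2.
have mbad : measurable [set y : shift_space G K2 | h2 (g \o y) != psi_letter be y].
  by apply: fmeasurable_neq => //; exact: mpsi_letter.
have mC : measurable [set y : shift_space G K2 | h2 (g \o y) == a].
  rewrite (_ : mkset _ = (fun y : shift_space G K2 => h2 (g \o y)) @^-1` [set a])//.
  by apply/seteqP; split => y /= /eqP.
rewrite -lee_fin fine_measureK// EFinD -[leRHS]adde0 -mu_nX2.
apply: le_trans (leeD (leeD muS he) (lexx _)).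
apply: le_trans (leeD (measureU2 mu2 mS mbad) (lexx _)).
apply: le_trans (measureU2 mu2 (measurableU _ _ mS mbad) (measurableC mX2)).
apply: le_measure; rewrite ?inE//.
  by apply: measurableU; [exact: measurableU|exact: measurableC].
move=> y /= /eqP hy; have [Xy|] := pselect (X2 y); last by right.
left; have [e|] := eqVneq (h2 (g \o y)) (psi_letter be y); last by right.
by left; split=> //; move: e; rewrite hy /psi_letter asboolT.
Qed.

(** A decoding error forces [h1] to err at [psi y], or [h2] to err at one of the translates of [y]
    indexed by [T1], up to a null set. Shift invariance gives each translate the error [e2]. *)
Lemma decoding_error_le (A A1 B : finType) (al : K2 -> A) (be : K1 -> A1) T1
    (h1 : (gcar G -> A1) -> A) (g : K2 -> B) T2 (h2 : (gcar G -> B) -> A1)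
    (c : B -> A) (e1 e2 : R) :
  fmeasurable al -> fmeasurable be -> fmeasurable g -> local T1 h1 -> local T2 h2 ->
  (forall k, c (g k) = al k) ->
  (mu1 [set x | h1 (be \o x) != phi_letter al x] <= e1%:E)%E ->
  (mu2 [set y | h2 (g \o y) != psi_letter be y] <= e2%:E)%E ->
  fine (mu2 (decoding_error g c h1 h2 Phi)) <= e1 + (size T1)%:R * e2.
Proof.
move=> mal mbe mg lh1 lh2 cg he1 he2.
pose bad1 := [set x : shift_space G K1 | h1 (be \o x) != phi_letter al x].
pose bad2 := [set y : shift_space G K2 | h2 (g \o y) != psi_letter be y].
have mbad1 : measurable bad1.
  by apply: fmeasurable_neq; [exact: fmeasurable_local lh1|exact: mphi_letter].
have mbad2 : measurable bad2.
  by apply: fmeasurable_neq; [exact: fmeasurable_local lh2|exact: mpsi_letter].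
have [|x []//|mE1 muE1] := mpsi (E := X1 `&` bad1); first exact: measurableI.
(* [sh e y] reads [y] at [gmul (Phi e) f], and its image under [psi] has at the identity the letter
   of [psi y] at [e]. *)
pose sh e : shift_space G K2 -> shift_space G K2 := Defs.shift (Phi (ginv e)).
pose E2 := \bigcup_(i in [set: 'I_(size T1)]) sh (tnth (in_tuple T1) i) @^-1` bad2.
have mE2 : measurable E2.
  by apply: fin_bigcup_measurable => // i _; exact: shift_measurable.
have muE2 : (mu2 E2 <= ((size T1)%:R * e2)%:E)%E.
  rewrite -[X in X%:R * _]card_ord.
  apply: (measure_bigU_le (F := fun i : 'I_(size T1) => sh (tnth (in_tuple T1) i) @^-1` bad2)) => //.
    by move=> i; exact: shift_measurable.
  by move=> i; rewrite (measure_shift mu2_prod).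
have mD : measurable (decoding_error g c h1 h2 Phi).
  apply: fmeasurable_neq.
    apply: (fmeasurable_local (T := [seq gmul (Phi e) f | e <- T1, f <- T2])
      (h := fun z => h1 (fun e => h2 (fun f => z (gmul (Phi e) f)))) mg).
    move=> z z' zz'; apply: lh1 => e eT; apply: lh2 => f fT; apply: zz'.
    by apply/allpairsP; exists (e, f).
  apply: (fmeasurable_local (T := [:: gone G]) (h := fun z => c (z (gone G))) mg).
  by move=> z z' zz'; rewrite zz'// inE.
have {}muE1 : (mu2 (X2 `&` psi @^-1` (X1 `&` bad1)) <= e1%:E)%E.
  rewrite muE1; apply: le_trans he1.
  by apply: le_measure; rewrite ?inE//; exact: measurableI.
rewrite -lee_fin fine_measureK// EFinD -[leRHS]adde0 -mu_nX2.
apply: le_trans (leeD (leeD muE1 muE2) (lexx _)).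
apply: le_trans (leeD (measureU2 mu2 mE1 mE2) (lexx _)).
apply: le_trans (measureU2 mu2 (measurableU _ _ mE1 mE2) (measurableC mX2)).
apply: le_measure; rewrite ?inE//.
  by apply: measurableU; [exact: measurableU|exact: measurableC].
move=> y hy; have [Xy|] := pselect (X2 y); last by right.
left; have [|nE2] := pselect (E2 y); first by right.
left; have [Xpy phipsi] := psiX Xy; split => //; split=> //.
move: hy; rewrite /decoding_error /bad1 /= /phi_letter asboolT// phipsi cg.
congr (is_true (_ != _)); apply: lh1 => e eT /=.
have [i ei] := seq_tnthP eT.
have : ~ bad2 (sh e y) by move=> b2; apply: nE2; exists i => //; rewrite /= -ei.
have [Xs psis] := psi_shift (ginv e) Xy.
move=> /negP; rewrite /= negbK /psi_letter /sh asboolT// psis => /eqP.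
rewrite {2}/Defs.shift ginvK gmulr1 => <-.
congr h2; apply/funext => f /=.
by rewrite /Defs.shift PhiV ginvK.
Qed.

Lemma partition_entropy_approx (A : finType) (al : K2 -> A) (eps : R) :
  fmeasurable al -> 0 < eps ->
  exists (A1 : finType) (be : K1 -> A1), fmeasurable be /\
    partition_entropy kappa2 al <= partition_entropy kappa1 be + eps.
Proof.
(* Five shares of [eps]: two for the terms [- ln (1 - eta)], one each for [B2 * e1], [C * e2] and
   the bad vertices. *)
move=> mal eps0; pose e := eps / 5; have e0 : 0 < e by rewrite divr_gt0.
pose eta := 1 - expR (- e).
have eta01 : 0 < eta < 1.
  by rewrite subr_gt0 expR_lt1 oppr_lt0 e0 gtrBl expR_gt0.
have lneta : ln (1 - eta) = - e by rewrite subKr expRK.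
pose B2 := - ln (eta / #|A|%:R).
have B2_ge0 : 0 <= B2 := mix_ln_bound_ge0 eta01 (sum_pmass kappa2 mal).
pose e1 := e / (B2 + 1).
have e1_gt0 : 0 < e1 by rewrite divr_gt0//; lra.
have [A1 [be [T1 [h1 [mbe lh1 he1]]]]] :=
  fmeasurable_approximable mu1 (mphi_letter mal) e1_gt0.
exists A1, be; split => //.
pose B1 := - ln (eta / #|A1|%:R).
have B1_ge0 : 0 <= B1 := mix_ln_bound_ge0 eta01 (sum_pmass kappa1 mbe).
pose C := #|A1|%:R * B1 + B2 * (size T1)%:R.
have C_ge0 : 0 <= C by rewrite addr_ge0 ?mulr_ge0.
(* The order of choices matters: [C] involves the alphabet [A1] and window [T1] produced by the
   first approximation, and [delta] below must precede the sofic model. *)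
pose e2 := e / (C + 1).
have e2_gt0 : 0 < e2 by rewrite divr_gt0//; lra.
have [B [g0 [T2 [h0 [mg0 lh0 he0]]]]] :=
  fmeasurable_approximable mu2 (mpsi_letter mbe) e2_gt0.
(* The quotient is refined by [al] so that [snd] recovers the partition whose entropy is bounded;
   [h2] ignores the added component. *)
pose g k := (g0 k, al k); have mg : fmeasurable g by exact: fmeasurable_pair.
pose h2 (z : gcar G -> B * A) := h0 (fst \o z).
have lh2 : local T2 h2 by move=> z z' zz'; apply: lh0 => t tT /=; rewrite zz'.
have he2 : (mu2 [set y | h2 (g \o y) != psi_letter be y] <= e2%:E)%E by [].
have derr := decoding_error_le (c := snd) mal mbe mg lh1 lh2 (fun=> erefl) he1 he2.
pose L := label_support T1 T2 Phi.
pose delta := e / (B1 + B2 + 1).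
have delta0 : 0 < delta by rewrite divr_gt0//; lra.
have [m [sigma [good [m0 goodP bad]]]] := sofic_good L Gsofic delta0.
have := coding_bound mu2_prod mg lh1 lh2 (Phi := Phi) (sigma := fun t => sigma t)
  (fun t => @perm_inj _ (sigma t)) eta01 (ltW e2_gt0) (pmass_ge0 kappa1 be)
  (sum_pmass kappa1 mbe) (fun a => label1_law_le a mbe mg lh2 he2) derr goodP.
rewrite card_ord -/B1 -/B2 -/(partition_entropy kappa1 be) lneta.
rewrite (_ : snd \o g = al)// => H.
have m0R : 0 < m%:R :> R by rewrite ltr0n.
rewrite -(ler_pM2l m0R); apply: (le_trans H).
have E1 : B2 * e1 <= e by apply: mul_div_succ_le => //; exact: ltW.
have E2 : C * e2 <= e by apply: mul_div_succ_le => //; exact: ltW.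
have E3 : (B1 + B2) * delta <= e by apply: mul_div_succ_le; [lra|exact: ltW].
have E4 : #|predC good|%:R * (B1 + B2) <= m%:R * e.
  apply: (@le_trans _ _ (delta * m%:R * (B1 + B2))).
    by apply: ler_wpM2r => //; rewrite addr_ge0.
  by rewrite mulrAC mulrC [delta * _]mulrC ler_wpM2l ?ler0n.
have -> : eps = e *+ 5 by rewrite /e -mulr_natr divfK.
apply: (le_trans (lerD (lexx _) E4)).
rewrite -mulrDr; apply: ler_wpM2l; first exact: ltW.
rewrite !mulrS mulr0n; move: E2; rewrite /C mulrDl.
have -> : B2 * (e1 + (size T1)%:R * e2) = B2 * e1 + B2 * (size T1)%:R * e2.
  by rewrite mulrDr [B2 * (_ * e2)]mulrA.
lra.
Qed.

Hypothesis m1K1 : forall k : K1, measurable [set k].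
Hypothesis m1K2 : forall k : K2, measurable [set k].

Lemma factor_entropy_le :
  (exists S : set K2, countable S /\ measurable S /\ kappa2 (~` S) = 0%E) ->
  (entropy kappa2 <= entropy kappa1)%E.
Proof.
move=> cS; apply: entropy_le => // A al mal; apply/lee_addgt0Pr => eps eps0.
have [A1 [be [mbe H]]] := partition_entropy_approx mal eps0.
apply: (@le_trans _ _ ((partition_entropy kappa1 be)%:E + eps%:E)%E).
  by rewrite -EFinD lee_fin.
by rewrite leeD2r// partition_entropy_le.
Qed.

End factor.

Lemma standard_Borel_set1 (R : realType) d (K : measurableType d) :
  standard_Borel R K -> forall k : K, measurable [set k].
Proof.
move=> [S [f [_ [_ [finj [mf _]]]]]] k.
rewrite (_ : [set k] = setT `&` f @^-1` [set f k]); first exact: mf.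
by apply/seteqP; split => [x ->//|x [_ /finj]].
Qed.

(** Finite entropy rules out the [+oo] branch of the definition. *)
Lemma entropy_fin_countable (R : realType) d (K : measurableType d)
    (kappa : probability K R) : (entropy kappa < +oo)%E ->
  exists S : set K, countable S /\ measurable S /\ kappa (~` S) = 0%E.
Proof. by rewrite /entropy; case: asboolP => // _; rewrite ltxx. Qed.

Theorem theorem1p10 (R : realType) (G : cgroup)
  (d1 : measure_display) (K1 : measurableType d1)
  (d2 : measure_display) (K2 : measurableType d2)
  (kappa1 : probability K1 R) (kappa2 : probability K2 R)
  (mu1 : probability (shift_space G K1) R)
  (mu2 : probability (shift_space G K2) R) :
  countable_group G -> sofic R G ->
  standard_Borel R K1 -> standard_Borel R K2 ->
  is_product_measure kappa1 mu1 -> is_product_measure kappa2 mu2 ->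
  (entropy kappa1 + entropy kappa2 < +oo)%E ->
  conj_up_to_aut mu1 mu2 ->
  entropy kappa1 = entropy kappa2.
Proof.
move=> _ Gsofic /standard_Borel_set1 mK1 /standard_Borel_set1 mK2 mu1P mu2P fin.
move=> [Phi [X1 [X2 [phi [psi [[[Psi PhiK PsiK] PhiM]
  [mX1 [X1_1 [mX2 [X2_1 [phiX [psiX [mphi [mpsi phi_shift]]]]]]]]]]]]]].
have fin1 : (entropy kappa1 < +oo)%E.
  by apply: le_lt_trans fin; rewrite leeDl// entropy_ge0.
have fin2 : (entropy kappa2 < +oo)%E.
  by apply: le_lt_trans fin; rewrite leeDr// entropy_ge0.
have PsiM x y : Psi (gmul x y) = gmul (Psi x) (Psi y).
  by apply: (can_inj PhiK); rewrite PhiM !PsiK.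
(* Equivariance passes to the inverse by writing [y] as [phi (psi y)]. *)
have psi_shift g y : X2 y ->
    X2 (Defs.shift (Phi g) y) /\ psi (Defs.shift (Phi g) y) = Defs.shift g (psi y).
  move=> Xy; have [Xp py] := psiX _ Xy; have [Xs ps] := phi_shift g _ Xp.
  have -> : Defs.shift (Phi g) y = phi (Defs.shift g (psi y)) by rewrite ps py.
  exact: phiX.
apply/eqP; rewrite eq_le; apply/andP; split.
(* The two systems exchange roles here, with [Psi], the inverse of [Phi], as the automorphism. *)
- apply: (@factor_entropy_le R G d2 d1 K2 K1 kappa2 kappa1 mu2 mu1 mu2P mu1P Gsofic
    Psi X2 X1 psi phi) => //.
  + by move=> y /psiX[].
  + by move=> E mE /mpsi[].
  + by move=> g x Xx; have := phi_shift (Psi g) x Xx; rewrite PsiK.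
  + exact: entropy_fin_countable.
- apply: (@factor_entropy_le R G d1 d2 K1 K2 kappa1 kappa2 mu1 mu2 mu1P mu2P Gsofic
    Phi X1 X2 phi psi) => //.
  + by move=> x /phiX[].
  + by move=> E mE /mphi[].
  + exact: entropy_fin_countable.
Qed.
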